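(* Let $G$ and $H$ be graphs such that $G,H\neq\emptyset$ (each has at least one vertex). Then the join $G\star H$ is diagonal, i.e. $\mathrm{MH}_{k,l}(G\star H)=0$ whenever $k\ne l$.
   Context: A graph is a finite undirected graph with no loops or multiple edges. $d(x,y)$ is the length of a shortest edge path from $x$ to $y$ ($\infty$ if in different components). The length of a tuple of vertices is $\ell(x_0,\dots,x_k)=\sum_{i=1}^{k} d(x_{i-1},x_i)$. $\mathrm{MC}_{k,l}(G)$ ($k,l\ge0$) is the free abelian group on tuples $(x_0,\dots,x_k)$ of vertices with consecutive entries distinct and $\ell(x_0,\dots,x_k)=l$. The differential $\partial\colon \mathrm{MC}_{k,l}(G)\to\mathrm{MC}_{k-1,l}(G)$ is $\partial=\sum_{i=1}^{k-1}(-1)^i\partial_i$, where $\partial_i$ omits the $i$-th entry $x_i$ if the resulting tuple still has length $l$, and is $0$ otherwise. $\mathrm{MH}_{k,l}(G)=H_k(\mathrm{MC}_{*,l}(G))$. A graph $G$ is diagonal if $\mathrm{MH}_{k,l}(G)=0$ for $k\neq l$. The join $G\star H$ is the graph obtained from the disjoint union $G\sqcup H$ by adding the edges $\{x,y\}$ for all $x\in V(G)$ and $y\in V(H)$. *)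

(* Defs.v *)
From HB Require Import structures.
From mathcomp Require Import all_boot all_order all_algebra.
From mathcomp Require Import boolp.
From mathcomp Require Import freeg.

Set Implicit Arguments.
Unset Strict Implicit.
Unset Printing Implicit Defensive.

Import GRing.Theory.
Local Open Scope ring_scope.

Record graph := Graph {
  vertex :> finType;
  edge : rel vertex;
  edge_sym : symmetric edge;
  edge_irr : irreflexive edge
}.

Section Join.
Variables G H : graph.

Definition join_edge (u v : vertex G + vertex H) : bool :=
  match u, v with
  | inl x, inl x' => edge x x'
  | inr y, inr y' => edge y y'
  | _, _ => true
  end.

Lemma join_edge_sym : symmetric join_edge.
Proof. by case=> x [] y //=; rewrite edge_sym. Qed.

Lemma join_edge_irr : irreflexive join_edge.
Proof. by case=> x /=; rewrite edge_irr. Qed.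

Definition join : graph := Graph join_edge_sym join_edge_irr.
End Join.

(* Lengths live in the extended natural numbers [option nat], where [None]    *)
(* stands for infinity.                                                       *)
Definition addoo (a b : option nat) : option nat :=
  match a, b with
  | Some m, Some n => Some (m + n)%N
  | _, _ => None
  end.

Lemma addooA : associative addoo.
Proof. by case=> [m|] [n|] [p|] //=; rewrite addnA. Qed.
Lemma addooC : commutative addoo.
Proof. by case=> [m|] [n|] //=; rewrite addnC. Qed.
Lemma add0oo : left_id (Some 0%N) addoo.
Proof. by case. Qed.

HB.instance Definition _ :=
  Monoid.isComLaw.Build (option nat) (Some 0%N) addoo addooA addooC add0oo.

Section MagnitudeHomology.
Variable G : graph.

(* There is an edge path with n edges from x to y. *)
Definition walk (x y : G) (n : nat) : bool :=
  [exists p : n.-tuple G, path (@edge G) x p && (last x p == y)].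

Definition dist (x y : G) : option nat :=
  if pselect (exists n, walk x y n) is left ex then Some (ex_minn ex) else None.

Definition len (s : seq G) : option nat :=
  if s is x :: s' then \big[addoo/Some 0%N]_(d <- pairmap dist x s') d
  else Some 0%N.

Definition generating (k l : nat) (x : k.+1.-tuple G) : bool :=
  sorted (fun u v => u != v) x && (len x == Some l).

Definition gen (k l : nat) := {x : k.+1.-tuple G | generating l x}.
Definition MC (k l : nat) := {freeg (gen k l) / int}.

Definition omit k (i : 'I_k.+2) (x : k.+2.-tuple G) : k.+1.-tuple G :=
  [tuple tnth x (fintype.lift i j) | j < k.+1].

(* When omitting an interior entry preserves the length, the new consecutive  *)
(* entries are still distinct, since their distance is a sum of two positive  *)
(* numbers; so for 0 < i < k.+1 the test made by [insub] is only on length.   *)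
Definition face k l (i : 'I_k.+2) (x : gen k.+1 l) : MC k l :=
  if insub (omit i (val x)) is Some y then << y >> else 0.

Definition boundary k l : MC k.+1 l -> MC k l :=
  fglift (fun x : gen k.+1 l =>
    \sum_(i < k.+2 | (0 < i < k.+1)%N) (-1) ^+ i *: face i x).

Lemma boundary_is_zmod_morphism k l : zmod_morphism (@boundary k l).
Proof. exact: lift_is_additive. Qed.

HB.instance Definition _ k l :=
  GRing.isZmodMorphism.Build (MC k.+1 l) (MC k l) (@boundary k l)
    (@boundary_is_zmod_morphism k l).

(* The complex is zero in negative degrees. *)
Definition is_cycle k l : MC k l -> bool :=
  match k with
  | 0 => fun=> true
  | k'.+1 => fun c : MC k'.+1 l => boundary c == 0
  end.

Lemma is_cycle_zmod_closed k l : zmod_closed (@is_cycle k l).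
Proof.
case: k => [|k]; first by split.
split=> [|c c']; rewrite !unfold_in; first exact/eqP/raddf0.
by move=> /eqP h /eqP h'; apply/eqP; rewrite raddfB /= h h' subrr.
Qed.

HB.instance Definition _ k l :=
  GRing.isZmodClosed.Build (MC k l) (@is_cycle k l) (@is_cycle_zmod_closed k l).

Record cycles k l := Cycle {
  cycle_val :> MC k l;
  cycle_valP : cycle_val \in @is_cycle k l
}.

HB.instance Definition _ k l := [isSub for @cycle_val k l].
HB.instance Definition _ k l := [Choice of cycles k l by <:].
HB.instance Definition _ k l := [SubChoice_isSubZmodule of cycles k l by <:].

Definition is_boundary k l : cycles k l -> bool :=
  fun z => `[< exists c : MC k.+1 l, boundary c = z >].

Lemma is_boundary_zmod_closed k l : zmod_closed (@is_boundary k l).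
Proof.
split=> [|z z']; rewrite !unfold_in.
  by apply/asboolP; exists 0; rewrite !raddf0.
move=> /asboolP[c hc] /asboolP[c' hc']; apply/asboolP; exists (c - c').
by rewrite !raddfB /= -hc -hc'.
Qed.

HB.instance Definition _ k l :=
  GRing.isZmodClosed.Build (cycles k l) (@is_boundary k l)
    (@is_boundary_zmod_closed k l).

Definition boundaries k l : zmodClosed (cycles k l) :=
  GRing.ZmodClosed.clone (cycles k l) (@is_boundary k l) _.

Definition MH k l : zmodType := Quotient.quot (boundaries k l).

End MagnitudeHomology.

Definition diagonal (G : graph) : Prop :=
  forall k l : nat, k <> l -> forall c : MH G k l, c = 0.

(* Main.v *)
Require Import Defs.
From mathcomp Require Import all_boot.
From HB Require Import structures.
From mathcomp Require Import all_algebra zify boolp freeg.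

Set Implicit Arguments.
Unset Strict Implicit.
Unset Printing Implicit Defensive.

Import GRing.Theory.
Local Open Scope ring_scope.

(** In a join of two nonempty graphs, vertices of different factors (of
    different sides) are adjacent, so every distance is 0, 1 or 2. A generator
    is therefore a word of vertices whose consecutive entries are at distance 1
    (a unit step) or 2 (a long step), and erasing y from ..., u, y, w, ... keeps
    the length exactly when both steps are unit and d(u, w) = 2. A long step
    joins two vertices of the same side, and such a step can always be broken by
    inserting any vertex of the other side. A word of degree k and length l has
    a long step as soon as k <> l, so it suffices to remove all long steps from
    a cycle by subtracting boundaries ([exact_off_diagonal]).

    This is done from left to right. Suppose that all words of the cycle c begin
    with n unit steps. In those whose next step y, w is long, insert a vertex b
    of the other side between y and w. Erasing b gives the word back, but the
    new word has another face, erasing y from x, y, b, which would create a long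
    step among the first n. The remedy is [detour]: from
    x_0 ... x_n b w r subtract x_0 ... x_(n-1) w b w r, add
    x_0 ... x_(n-2) b w b w r, and so on, replacing an ever longer tail of the
    prefix by a zigzag, as long as the steps of the replaced tail change sides.
    Each new term cancels the unwanted face of the preceding one, and inside the
    zigzag all faces vanish since its entries at distance two in the word are
    equal. The outcome is an operator with three properties:
    - erasing b yields the original word ([insertion_face_across]);
    - erasing x_n yields 0 ([insertion_face_last]);
    - erasing an earlier x_i commutes with the operator ([insertion_face]). The
      erasure leaves a long step, which stays on one side, and the zigzag cannot
      get past it; this cuts off precisely the terms in which x_i is no longer
      present.

    Since all words of c begin with n unit steps, the faces of c erasing
    x_1, ..., x_(n-1) have their first long steps at different places and cannot
    cancel each other or any other face; c being a cycle, each of them is 0.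
    By commutation the same faces of the insertion vanish
    ([insertion_long_face_left]). What remains of its boundary is, up to sign,
    the part of c to be removed, plus words beginning with n + 1 unit steps
    ([extend_unit_prefix]). *)

(** * Integral chains and their supports *)

Section Lift.
Variables (K : choiceType) (M : lmodType int) (f : K -> M).
Implicit Types c : {freeg K / int}.

HB.instance Definition _ :=
  GRing.isZmodMorphism.Build {freeg K / int} M (fglift f)
    (@lift_is_additive _ _ _ f).

Lemma fglift1 x : fglift f << x >> = f x.
Proof. by rewrite liftU scale1r. Qed.

Lemma fglift_sum c : fglift f c = \sum_(z <- dom c) coeff z c *: f z.
Proof.
rewrite -{1}(freeg_sumE c) raddf_sum; apply: eq_bigr => z _.
by rewrite /= liftU.
Qed.

Lemma fgliftZ a c : fglift f (a *: c) = a *: fglift f c.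
Proof.
rewrite -{1}(freeg_sumE c) scaler_sumr raddf_sum fglift_sum scaler_sumr.
apply: eq_bigr => z _; rewrite scalerA -(liftU f); congr fglift.
by apply/eqP/freeg_eqP => y; rewrite coeffZ !coeffU mulrA.
Qed.
End Lift.

Section Support.
Variable K : choiceType.
Implicit Types (c d : {freeg K / int}).

Lemma freegUE a (x : K) : << a *g x >> = a *: << x >> :> {freeg K / int}.
Proof. by apply/eqP/freeg_eqP => z; rewrite coeffZ !coeffU mul1r. Qed.

Lemma fglift_comp (M : lmodType int) (L : choiceType) (g : L -> M)
    (f : K -> {freeg L / int}) c :
  fglift g (fglift f c) = fglift (fun x => fglift g (f x)) c.
Proof.
rewrite (fglift_sum f c) raddf_sum [RHS]fglift_sum; apply: eq_bigr => z _.
by rewrite /= fgliftZ.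
Qed.

Definition supported (P : pred K) c := all P (dom c).

Lemma supportedP (P : pred K) c :
  reflect (forall z, coeff z c != 0 -> P z) (supported P c).
Proof.
apply: (iffP allP) => h z; first by rewrite -mem_dom => /h.
by rewrite mem_dom => /h.
Qed.

Lemma eq_fglift (M : lmodType int) (P : pred K) (f g : K -> M) c :
  supported P c -> {in P, f =1 g} -> fglift f c = fglift g c.
Proof.
move=> /allP Pc fg; rewrite !fglift_sum.
by apply: eq_big_seq => z /Pc Pz; rewrite fg.
Qed.

Lemma supported_eq0 (P : pred K) c :
  (forall x, ~~ P x) -> supported P c -> c = 0.
Proof.
move=> nP cP; apply/eqP; rewrite -dom_eq0; move: cP; rewrite /supported.
by case: (dom c) => //= x s; rewrite (negbTE (nP x)).
Qed.

Lemma supported0 P : supported P 0.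
Proof. by apply/supportedP => z; rewrite coeff0 eqxx. Qed.

Lemma supportedD P c d : supported P c -> supported P d -> supported P (c + d).
Proof.
move=> /supportedP hc /supportedP hd; apply/supportedP => z; rewrite coeffD.
by have [-> |/hc //] := eqVneq (coeff z c) 0; rewrite add0r => /hd.
Qed.

Lemma supportedZ P a c : supported P c -> supported P (a *: c).
Proof.
move=> /supportedP hc; apply/supportedP => z; rewrite coeffZ.
apply: contraNT => /(contraNN (hc z)); rewrite negbK => /eqP ->.
by rewrite mulr0.
Qed.

Lemma supportedB P c d : supported P c -> supported P d -> supported P (c - d).
Proof. by move=> hc hd; rewrite -scaleN1r supportedD ?supportedZ. Qed.

Lemma supportedU (P : pred K) x : P x -> supported P << x >>.
Proof. by rewrite /supported domU1 /= => ->. Qed.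

Lemma supported_sum P (I : Type) (r : seq I) (Q : pred I)
    (F : I -> {freeg K / int}) :
  (forall i, Q i -> supported P (F i)) ->
  supported P (\sum_(i <- r | Q i) F i).
Proof.
move=> h; elim/big_rec: _ => [|i c /h Fi cP]; first exact: supported0.
exact: supportedD.
Qed.
End Support.

Lemma supported_fglift (K L : choiceType) (P : pred K) (Q : pred L)
    (f : K -> {freeg L / int}) c :
  supported P c -> (forall x, P x -> supported Q (f x)) ->
  supported Q (fglift f c).
Proof.
move=> /allP Pc h; rewrite fglift_sum big_seq; apply: supported_sum => z /Pc Pz.
by rewrite supportedZ ?h.
Qed.

(** * Words of vertices and their faces *)

Section Words.
Variable G : graph.
Implicit Types (s t p q P T : seq G) (u v w x y : G).
Local Notation chain := {freeg (seq G) / int}.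
Implicit Types c d : chain.

(** The distance function of a graph of diameter at most 2; see
    [dist_step]. *)
Definition step u v : nat := if u == v then 0 else if edge u v then 1 else 2.

Definition steps s : seq nat :=
  if s is x :: s' then pairmap step x s' else [::].

Lemma size_steps s : size (steps s) = (size s).-1.
Proof. by case: s => //= x s; rewrite size_pairmap. Qed.

Lemma step_le2 s i : (nth 0%N (steps s) i <= 2)%N.
Proof.
have [h|h] := ltnP i (size (steps s)); last by rewrite nth_default.
case: s h => // x s; rewrite /= size_pairmap => h.
rewrite (nth_pairmap x) // /step.
by case: ifP => // _; case: ifP.
Qed.

Lemma steps_cat p u q :
  steps (p ++ u :: q) = steps (rcons p u) ++ pairmap step u q.
Proof.
case: p => [|x p] //=; rewrite -cat_rcons pairmap_cat; congr (_ ++ _).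
by rewrite last_rcons.
Qed.

(** The prefix is given in reverse, the form in which [detour] consumes it. *)
Lemma split_step2 n s : nth 0%N (steps s) n = 2%N ->
  exists P y w T,
    [/\ s = catrev (y :: P) (w :: T), size P = n & step y w = 2%N].
Proof.
move=> s2; have sn : (n.+1 < size s)%N.
  have := size_steps s; case: (ltnP n (size (steps s))) => [|h]; first lia.
  by rewrite nth_default in s2.
case: s s2 sn => // x s s2 sn.
exists (rev (take n (x :: s))), (nth x (x :: s) n), (nth x (x :: s) n.+1).
exists (drop n.+2 (x :: s)).
split.
- rewrite catrevE rev_cons revK cat_rcons -!drop_nth ?cat_take_drop //.
  exact: ltnW.
- by rewrite size_rev size_take; case: ifP => //; move/negbT; lia.
- by move: s2; rewrite /= (nth_pairmap x) /=.
Qed.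

Definition same_steps s p : bool := (size p == size s) && (steps p == steps s).

(** The generators of degree k and length l, as untyped sequences, so that
    faces of different degrees live in one module. *)
Definition word k l s : bool :=
  [&& size s == k.+1, 0%N \notin steps s & sumn (steps s) == l].

Definition unit_prefix n s : bool := all (pred1 1%N) (take n (steps s)).

Lemma unit_prefix_nth n s i :
  (n <= size (steps s))%N -> unit_prefix n s -> (i < n)%N ->
  nth 0%N (steps s) i = 1%N.
Proof.
move=> ns /allP h lin; rewrite -(nth_take 0%N lin); apply/eqP/h/mem_nth.
by rewrite size_takel.
Qed.

(** The face erasing entry [i.+1], which turns the unit steps [i] and [i.+1]
    into one long step. In diameter 2 no other erasure preserves the length; see
    [fuse_omit]. *)
Fixpoint fuse i s : option (seq G) :=
  match i, s with
  | 0, u :: v :: w :: s' =>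
    if [&& step u v == 1, step v w == 1 & step u w == 2]%N
    then Some (u :: w :: s') else None
  | i'.+1, x :: s' => omap (cons x) (fuse i' s')
  | _, _ => None
  end.

Lemma fuse_cat p i s : fuse (size p + i)%N (p ++ s) = omap (cat p) (fuse i s).
Proof. by elim: p => [|x p IH] /=; [case: fuse | rewrite IH; case: fuse]. Qed.

Lemma fuse_catl i p s : (i.+2 < size p)%N ->
  fuse i (p ++ s) = omap (cat^~ s) (fuse i p).
Proof.
elim: i p => [|i IH] [|x p] //=.
  by case: p => [|v [|w p]] //= _; case: ifP.
by rewrite ltnS => /IH ->; case: fuse.
Qed.

Lemma fuse_head i y s t : fuse i (y :: s) = Some t -> exists t', t = y :: t'.
Proof.
case: i => [|i] /=.
  by case: s => [|v [|w s]] //=; case: ifP => // _ [<-]; exists (w :: s).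
by case: fuse => //= t' [<-]; exists t'.
Qed.

Lemma fuse_last i s u t :
  fuse i (rcons s u) = Some t -> exists t', t = rcons t' u.
Proof.
elim: i s t => [|i IH] [|x s] t //=.
  case: s => [|v [|w s]] //=; case: ifP => // _ [<-]; first by exists [:: x].
  by exists [:: x, w & s].
  by case: i {IH}.
by case E: fuse => [t'|] //= [<-]; have [q ->] := IH _ _ E; exists (x :: q).
Qed.

Lemma fuseP i s t : fuse i s = Some t ->
  [/\ (i.+2 < size s)%N, nth 0%N (steps s) i = 1%N, nth 0%N (steps s) i.+1 = 1%N
    & steps t = take i (steps s) ++ 2%N :: drop i.+2 (steps s)].
Proof.
elim: i s t => [|i IH] [|x s] t //=.
  case: s => [|v [|w s]] //=.
  case: ifP => // /and3P[/eqP h1 /eqP h2 /eqP h3] [<-] /=.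
  by rewrite drop0 h3.
case E: (fuse i s) => [t'|] //= [<-]; have [h1 h2 h3 h4] := IH _ _ E.
case: s E h1 h2 h3 h4 => [|y s] // E h1 h2 h3 h4.
by have [t'' et] := fuse_head E; rewrite et /= in h4 *; rewrite h4.
Qed.

#[local] Arguments fuse : simpl never.

Lemma fuseS i x s : fuse i.+1 (x :: s) = omap (cons x) (fuse i s).
Proof. by []. Qed.

Lemma fuse0 u v w s : fuse 0 (u :: v :: w :: s) =
  if [&& step u v == 1, step v w == 1 & step u w == 2]%N
  then Some (u :: w :: s) else None.
Proof. by []. Qed.

Lemma fuse_catrev P i T :
  fuse (size P + i)%N (catrev P T) = omap (catrev P) (fuse i T).
Proof.
rewrite catrevE -(size_rev P) fuse_cat.
by case: fuse => //= q; rewrite catrevE.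
Qed.

Lemma fuse_size i s p : fuse i s = Some p -> size s = (size p).+1.
Proof.
elim: i s p => [|i IH] [|x s] p //=.
  by case: s => [|v [|w s]] //; rewrite fuse0; case: ifP => // _ [<-].
by rewrite fuseS; case E: fuse => [p'|] //= [<-] /=; rewrite (IH _ _ E).
Qed.

Lemma fuse_word i k l s p : fuse i s = Some p -> word k.+1 l s -> word k l p.
Proof.
move=> E /and3P[/eqP ss s0 /eqP sl]; have := fuse_size E; rewrite ss => -[sp].
have [si s1 s2 ep] := fuseP E.
have es : steps s = take i (steps s) ++ [:: 1, 1 & drop i.+2 (steps s)]%N.
  rewrite -[LHS](cat_take_drop i) (drop_nth 0%N) ?size_steps; last lia.
  by rewrite s1 (drop_nth 0%N) ?size_steps; [rewrite s2 | lia].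
rewrite /word ep -sp eqxx /=; move: s0 sl es.
move: (take i _) (drop _ _) => a d + + es; rewrite es.
by rewrite !mem_cat !inE !sumn_cat /= => -> <-; apply/eqP.
Qed.

Lemma unfuse_word n k l s p :
  word k l s -> nth 0%N (steps s) n = 2%N -> size p = (size s).+1 ->
  steps p = take n (steps s) ++ [:: 1, 1 & drop n.+1 (steps s)]%N ->
  word k.+1 l p.
Proof.
case/and3P=> /eqP ss s0 /eqP sl s2 sp ep; rewrite /word sp ss eqxx ep /=.
have ns : (n < size (steps s))%N.
  by case: ltnP => // h; rewrite nth_default in s2.
move: s0 sl; rewrite -{1 2}(cat_take_drop n (steps s)) (drop_nth 0%N) ?s2 //.
by rewrite !mem_cat !inE !sumn_cat /= => -> <-; apply/eqP.
Qed.

(** Inside a prefix of unit steps, the place of the first long step of a face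
    tells which vertex was erased. Hence such faces of different indices have
    disjoint supports. *)
Lemma fuse_first_long i m n s p :
  fuse m s = Some p -> (n <= size (steps s))%N -> unit_prefix n s ->
  (i < n)%N ->
  unit_prefix i p && (nth 0%N (steps p) i == 2%N) = (m == i).
Proof.
move=> /fuseP[ms _ _ ep] ns sn lin; rewrite /unit_prefix ep.
have s1 j : (j < n)%N -> nth 0%N (steps s) j = 1%N := unit_prefix_nth ns sn.
have st : size (take m (steps s)) = m by rewrite size_takel // size_steps; lia.
have [lmi|lim|mi] := ltngtP m i.
- apply/negP => /andP[/allP /(_ 2%N) h _].
  have /h // : 2%N \in take i (take m (steps s) ++ 2%N :: drop m.+2 (steps s)).
  rewrite take_cat st ltnNge (ltnW lmi) mem_cat.
  by rewrite -[(i - m)%N]prednK ?subn_gt0 // inE eqxx orbT.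
- by rewrite nth_cat st lim nth_take // s1 // andbF.
rewrite -mi in lin *; rewrite take_size_cat // nth_cat st ltnn subnn andbT.
apply/allP => a /(nthP 0%N)[j]; rewrite st => jm <-.
by rewrite nth_take // s1 //; lia.
Qed.

(** The simplicial identity. For [i = j] both sides are [None]: the first
    erasure makes step [i] long, and a long step takes part in no further
    erasure. *)
Lemma fuse_fuse i j s : (i <= j)%N ->
  obind (fuse i) (fuse j.+1 s) = obind (fuse j) (fuse i s).
Proof.
have fuseN k u v : fuse k [:: u; v] = None by case: k => [|[|[]]].
elim: i j s => [|i IH] j [|u s] //; last first.
  case: j => // j ij; have := IH j s ij; rewrite !fuseS.
  case: (fuse j.+1 s) => [t|]; case: (fuse i s) => [t'|] //=; rewrite ?fuseS.
  - by move=> ->.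
  - by move=> ->.
  - by move=> <-.
case: s => [|v [|w s]] //; first by case: j => [|[]].
  by case: j => [|j]; rewrite fuseN.
case: j => [|j] _.
  transitivity (None : option (seq G)).
    case: s => [|x s]; first by rewrite fuseS fuseN.
    rewrite fuseS fuse0; case: ifP => //= /and3P[_ _ /eqP E].
    by rewrite fuse0 E andbF.
  rewrite [in RHS]fuse0; case: ifP => //= /and3P[_ _ /eqP E].
  by case: s => [|x s]; rewrite ?fuseN // fuse0 E.
rewrite !fuseS fuse0; case E: (fuse j (w :: s)) => [t|] /=; last first.
  by case: ifP => //= _; rewrite fuseS E.
have [t' et] := fuse_head E; rewrite et fuse0.
by case: ifP => //= _; rewrite fuseS E et.
Qed.

Definition of_option (o : option (seq G)) : chain :=
  oapp (fun t => << t >>) 0 o.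

Definition fuse_chain i s : chain := of_option (fuse i s).

Definition face_op i : chain -> chain := fglift (fuse_chain i).

HB.instance Definition _ i := GRing.Additive.on (face_op i).

(** The magnitude differential on words of degree [k.+1]; the face of index [i]
    erases entry [i.+1], hence the sign. *)
Definition bd k c : chain := \sum_(i < k) (-1) ^+ i.+1 *: face_op i c.

Lemma bd_is_zmod_morphism k : zmod_morphism (bd k).
Proof.
move=> c d; rewrite /bd -sumrB; apply: eq_bigr => i _.
by rewrite raddfB scalerBr.
Qed.

HB.instance Definition _ k :=
  GRing.isZmodMorphism.Build chain chain (bd k) (@bd_is_zmod_morphism k).

Lemma face_of_option i o :
  face_op i (of_option o) = of_option (obind (fuse i) o).
Proof. by case: o => [t|] /=; rewrite /face_op ?raddf0 // fglift1. Qed.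

Lemma face_opU i s : face_op i << s >> = fuse_chain i s.
Proof. exact: fglift1. Qed.

Lemma faceZ i a c : face_op i (a *: c) = a *: face_op i c.
Proof. exact: fgliftZ. Qed.

Lemma face_face i j c : (i <= j)%N ->
  face_op i (face_op j.+1 c) = face_op j (face_op i c).
Proof.
move=> ij; rewrite /face_op !fglift_comp !fglift_sum; apply: eq_bigr => s _.
by congr (_ *: _); rewrite -!/(face_op _ _) !face_of_option fuse_fuse.
Qed.

Lemma bdZ k a c : bd k (a *: c) = a *: bd k c.
Proof.
by rewrite /bd scaler_sumr; apply: eq_bigr => i _; rewrite faceZ !scalerA mulrC.
Qed.

(** Adding the last face to the differential at each stage of the induction
    leaves the terms [face_op k (bd k c)] and [face_op k (face_op k c)], each
    occurring twice with opposite signs. *)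
Lemma bd_bd k c : bd k (bd k.+1 c) = 0.
Proof.
elim: k => [|k IH]; first by rewrite /bd big_ord0.
have bdS m d : bd m.+1 d = bd m d + (-1) ^+ m.+1 *: face_op m d.
  by rewrite /bd big_ord_recr.
have bd_face : bd k (face_op k.+1 c) = face_op k (bd k c).
  rewrite /bd raddf_sum; apply: eq_bigr => i _.
  by rewrite /= faceZ face_face // ltnW.
rewrite [bd k.+1 _]bdS [bd k.+2 c]bdS raddfD /= IH add0r bdZ bd_face raddfD /=.
rewrite scalerDr faceZ face_face // [bd k.+1 c]bdS raddfD /= faceZ scalerDr.
by rewrite [_ ^+ k.+2]exprS mulN1r !scaleNr scalerN addrK addNr.
Qed.

End Words.

Arguments fuse : simpl never.

(** * Breaking a long step by a zigzag *)

Section TwoSides.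
Variables (G : graph) (side : G -> bool) (across : G -> G).
Hypothesis cross_edge : forall u v, side u != side v -> edge u v.
Hypothesis side_across : forall u, side (across u) != side u.
Implicit Types (s p q P T : seq G) (u v w x y t : G).
Local Notation chain := {freeg (seq G) / int}.
Implicit Types c : chain.

Lemma step_cross u v : side u != side v -> step u v = 1%N.
Proof.
move=> uv; rewrite /step (cross_edge uv).
by case: (u =P v) uv => [->|//]; rewrite eqxx.
Qed.

Lemma step2_side u v : step u v = 2%N -> side u = side v.
Proof. by have [//|/step_cross ->] := eqVneq (side u) (side v). Qed.

(** The alternating sum described at the top, for the word [rev P ++ T], where
    [T] starts with the zigzag built so far. The reversed prefix makes the
    recursion structural. The entry added to the zigzag is the second one of
    [T], so that the zigzag keeps alternating between the same two vertices. *)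
Fixpoint detour P T : chain :=
  if P is y :: P' then
    << catrev P T >> -
    (if P' is u :: _ then
       if side u != side y then detour P' (nth y T 1 :: T) else 0
     else 0)
  else 0.

(** The head of [P] and the second entry of [T] lie opposite the head of [T], so
    that the latter can replace the former between vertices of the side of the
    head of [T]. *)
Definition alternating P T : bool :=
  match P, T with
  | y :: _, t :: t' :: _ => (side y != side t) && (side t' != side t)
  | _, _ => false
  end.

Lemma alternating_next y u P T :
  alternating (y :: u :: P) T -> side u != side y ->
  alternating (u :: P) (nth y T 1 :: T).
Proof.
case: T => [|t [|t' T]] //= /andP[h1 h2] h3; move: h1 h2 h3.
by case: (side y) (side t) (side t') (side u) => [] [] [] [].
Qed.

(** Every exchange replaces a vertex by another one of the same side between
    neighbours of the other side, hence does not change any step. *)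
Lemma detour_supported P T : alternating P T ->
  supported (same_steps (catrev P T)) (detour P T).
Proof.
elim: P T => [|y [|u P] IH] T // aT.
  by rewrite /= subr0 supportedU // /same_steps !eqxx.
rewrite [detour _ _]/= -/(detour (u :: P) _).
rewrite -[catrev P (u :: y :: T)]/(catrev (y :: u :: P) T).
apply: supportedB; first by rewrite supportedU // /same_steps !eqxx.
case: ifP => uy; last exact: supported0.
have aT' := alternating_next aT uy; have := IH _ aT'.
case: T aT aT' => [|t [|t' T]] //= /andP[yt t't] /andP[ut' _].
rewrite /supported; apply: etrans; apply: eq_all => s.
rewrite /same_steps !catrevE !size_cat /= !steps_cat /=.
by rewrite !step_cross // eq_sym.
Qed.

(** A vertex of [T] that cannot be erased from [T] cannot be erased from any
    term, because the later terms only put more vertices in front of [T]. *)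
Lemma detour_face_tail P j T :
  fuse j T = None -> face_op (size P + j)%N (detour P T) = 0.
Proof.
elim: P j T => [|y P IH] j T Tj; first by rewrite raddf0.
rewrite [detour _ _]/= raddfB /= face_opU /fuse_chain.
rewrite -[catrev P (y :: T)]/(catrev (y :: P) T).
rewrite -[(_ + j)%N]/(size (y :: P) + j)%N fuse_catrev Tj sub0r.
case: P IH => [|u P] IH; first by rewrite raddf0 oppr0.
case: ifP => _; last by rewrite raddf0 oppr0.
by rewrite addSnnS IH ?oppr0 // fuseS Tj.
Qed.

(** Only the first term has a face at the head of [T]: in the later ones this
    vertex stands between two copies of its successor. *)
Lemma detour_face_joint y P t t' T :
  face_op (size P) (detour (y :: P) [:: t', t & T]) =
  fuse_chain (size P) (catrev (y :: P) [:: t', t & T]).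
Proof.
rewrite [detour _ _]/= raddfB /= face_opU.
case: P => [|u P]; first by rewrite raddf0 subr0.
case: ifP => _; last by rewrite raddf0 subr0.
rewrite -[X in face_op X]addn0 detour_face_tail ?subr0 //.
by rewrite fuse0 /step eqxx andbC andbF.
Qed.

(** The telescoping step: the face of the first term at the last vertex [y] of
    the prefix equals the face of the second term at the vertex put in place of
    [y], because erasing either vertex leaves the same word. When the second
    term is absent, [u] is on the side of [y], hence adjacent to the head of
    [T], and the face is 0. *)
Lemma detour_face_last y u P T : alternating (y :: u :: P) T ->
  face_op (size P) (detour (y :: u :: P) T) = 0.
Proof.
case: T => [|t [|t' T]] //= /andP[yt t't].
rewrite raddfB /= face_opU.
have fuse3 v T' : fuse_chain (size P) (catrev P [:: u, v, t & T']) =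
    if [&& step u v == 1, step v t == 1 & step u t == 2]%N
    then << catrev P [:: u, t & T'] >> else 0.
  rewrite /fuse_chain -[X in fuse X]addn0 fuse_catrev fuse0.
  by case: ifP.
rewrite fuse3 (step_cross yt) /=.
have [uy|uy] := boolP (side u == side y).
  by rewrite raddf0 subr0 (@step_cross u t) ?(eqP uy) // andbF.
rewrite detour_face_joint /= fuse3 (step_cross uy) (step_cross t't).
rewrite (@step_cross u t') ?subrr //.
by move: uy yt t't; case: (side u) (side y) (side t) (side t') => [] [] [] [].
Qed.

(** Erasing an inner vertex of the prefix leaves a long step, which stays on one
    side and so stops the recursion of [detour]. On the left, the terms whose
    zigzag reaches the erased vertex sum to 0 by [detour_face_last]. *)
Lemma detour_face i P T : alternating P T -> (i.+2 < size P)%N ->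
  face_op i (detour P T) = oapp (fun q => detour (rev q) T) 0 (fuse i (rev P)).
Proof.
elim: P T => [|y [|u P] IH] T // aT iP.
rewrite [detour _ _]/= -/(detour (u :: P) _) raddfB /= face_opU.
rewrite -[catrev P _]/(catrev (y :: u :: P) T) /fuse_chain catrevE.
rewrite fuse_catl ?size_rev // [rev (y :: _)]rev_cons.
move: iP; rewrite /= !ltnS leq_eqVlt => /orP[/eqP ei|iP].
  (* The erased vertex is [u], the one just before the last. *)
  case: P IH aT ei => [|v P] //= IH aT [->].
  have -> : face_op (size P) (if side u != side y then
       detour [:: u, v & P] (nth y T 1 :: T) else 0) = 0.
    case: ifP => uy; last by rewrite raddf0.
    exact/detour_face_last/(alternating_next aT uy).
  rewrite subr0 !rev_cons -!cats1 -!catA -[X in fuse X]addn0 -(size_rev P).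
  rewrite fuse_cat fuse0.
  case: ifP => //= /and3P[_ _ /eqP vy].
  by rewrite rev_cat /= revK (step2_side vy) eqxx subr0 catrevE -catA.
rewrite -cats1 fuse_catl ?size_rev //; have {}IH := IH _ _ iP.
case E: (fuse i (rev (u :: P))) IH => [q|] IH /=; last first.
  case: ifP => [uy|_]; last by rewrite raddf0 subr0.
  by rewrite sub0r -/(detour (u :: P) _) IH ?oppr0 // (alternating_next aT uy).
have [q' eq] : exists q', q = rcons q' u.
  by move: E; rewrite rev_cons => /fuse_last.
rewrite eq cats1 rev_rcons rev_rcons /= -/(detour (u :: rev q') _) cat_rcons.
rewrite [catrev (rev q') _]catrevE revK -/(detour (u :: P) _).
congr (_ - _); first by rewrite -?cat_rcons ?cat_rcons.
case: ifP => [uy|_]; last exact: raddf0.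
by rewrite IH ?(alternating_next aT uy) //= eq rev_rcons.
Qed.
(** Step [n] joins entries [n] and [n.+1], so the prefix has [n.+1] entries. *)
Definition insertion n s : chain :=
  if drop n.+1 s is w :: r
  then detour (rev (take n.+1 s)) [:: across w, w & r] else 0.

Definition insertion_long n s : chain :=
  if nth 0%N (steps s) n == 2%N then insertion n s else 0.

Lemma insertionE n y P w T : size P = n ->
  insertion n (catrev (y :: P) (w :: T)) =
  detour (y :: P) [:: across w, w & T].
Proof.
move=> sP; rewrite /insertion catrevE.
have sr : size (rev (y :: P)) = n.+1 by rewrite size_rev /= sP.
by rewrite drop_size_cat // take_size_cat // revK.
Qed.

Lemma alternating_across y P w T :
  step y w = 2%N -> alternating (y :: P) [:: across w, w & T].
Proof.
by move=> yw; rewrite /= (step2_side yw) andbb eq_sym side_across.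
Qed.

Lemma insertion_face i n s : nth 0%N (steps s) n = 2%N -> (i.+1 < n)%N ->
  face_op i (insertion n s) = oapp (insertion n.-1) 0 (fuse i s).
Proof.
move=> /split_step2[P [y [w [T [-> sP yw]]]]] lin; rewrite insertionE //.
rewrite detour_face ?alternating_across //=; last lia.
rewrite -[catrev P _]/(catrev (y :: P) (w :: T)) catrevE.
rewrite fuse_catl ?size_rev /=; last lia.
case E: (fuse i (rev (y :: P))) => [q|] //=.
have sq : size q = n by have := fuse_size E; rewrite size_rev /= sP => -[].
case: n lin {sP} sq => // n _ sq.
by rewrite /insertion drop_size_cat // take_size_cat.
Qed.

Lemma insertion_face_last n s : nth 0%N (steps s) n.+1 = 2%N ->
  face_op n (insertion n.+1 s) = 0.
Proof.
move=> /split_step2[[|u P] [y [w [T [-> // [sP] yw]]]]].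
by rewrite insertionE /= ?sP // -sP detour_face_last ?alternating_across.
Qed.

Lemma insertion_face_across n s : nth 0%N (steps s) n = 2%N ->
  face_op n (insertion n s) = << s >>.
Proof.
move=> /split_step2[P [y [w [T [-> sP yw]]]]].
rewrite insertionE // -sP detour_face_joint /fuse_chain.
rewrite -[in fuse _]/(catrev P [:: y, across w, w & T]) -[X in fuse X]addn0.
rewrite fuse_catrev fuse0.
have /andP[h1 h2] := alternating_across P T yw.
by rewrite (step_cross h1) (@step_cross (across w) w) ?yw.
Qed.

(** All terms have the steps of the plain insertion: the long step [n] is
    replaced by two unit steps. *)
Lemma insertion_supported n s : nth 0%N (steps s) n = 2%N ->
  supported (fun p => (size p == (size s).+1) &&
    (steps p == take n (steps s) ++ [:: 1, 1 & drop n.+1 (steps s)]%N))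
    (insertion n s).
Proof.
move=> /split_step2[P [y [w [T [-> sP yw]]]]]; rewrite insertionE //.
have aP := alternating_across P T yw.
have := detour_supported aP; rewrite /supported; apply: etrans.
have /andP[h1 h2] := aP.
apply: eq_all => p.
rewrite /same_steps !catrevE !rev_cons !cat_rcons !size_cat /= addnS.
rewrite !addnS !steps_cat /=.
rewrite (step_cross h1) (@step_cross (across w) w) //.
have sz : size (steps (rcons (rev P) y)) = n.
  by rewrite size_steps size_rcons size_rev.
by rewrite take_size_cat // drop_cat sz ltnNge leqnSn subSnn /= drop0.
Qed.
(** The faces at the first vertices of the inserted chain vanish for a cycle.
    The face erasing the last vertex of the prefix is 0 on each word. For an
    earlier one, the linear map [reinsert] applied to the boundary of [c]
    selects the single face of index [i], the first long step of which is at
    [i], and performs the insertion on it; by [insertion_face] this is the face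
    of the insertion. *)
Lemma insertion_long_face_left i n c k : (i < n)%N -> (n <= k)%N ->
  supported (fun s => (size s == k.+2) && unit_prefix n s) c -> bd k c = 0 ->
  face_op i (fglift (insertion_long n) c) = 0.
Proof.
move=> lin nk cP bc; rewrite [LHS]fglift_comp.
have [ei|ni] := eqVneq i.+1 n.
  rewrite fglift_sum big1 // => s _; rewrite /insertion_long.
  case: eqP => [s2|_]; last by rewrite [fglift _ _]raddf0 scaler0.
  rewrite -ei in s2 *.
  by rewrite [fglift _ _](insertion_face_last s2) scaler0.
(* After the erasure, the long step [n] has become step [n.-1]. *)
pose reinsert s := if [&& unit_prefix i s, nth 0%N (steps s) i == 2%N
    & nth 0%N (steps s) n.-1 == 2%N] then insertion n.-1 s else 0.
pose faced s := face_op i (insertion_long n s).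
have reinsert_face m : (m < k)%N ->
    fglift reinsert (face_op m c) = if m == i then fglift faced c else 0.
  move=> mk; rewrite [LHS]fglift_comp.
  have -> : (if m == i then fglift faced c else 0) =
     fglift (fun s => if m == i then faced s else 0) c.
    by case: eqP => // _; rewrite fglift_sum big1 // => s _; rewrite scaler0.
  apply: eq_fglift cP _ => s /andP[/eqP ss sn].
  have sz : size (steps s) = k.+1 by rewrite size_steps ss.
  rewrite /fuse_chain; case E: (fuse m s) => [p|] /=; last first.
    rewrite raddf0; case: eqP => // mi; rewrite /faced /insertion_long.
    case: eqP => [s2|_]; last by rewrite raddf0.
    by rewrite (insertion_face s2) -?mi ?E //; lia.
  rewrite fglift1 /reinsert andbA (fuse_first_long E _ sn) ?sz //; last lia.
  case: eqP => //= mi; rewrite /faced /insertion_long.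
  have -> : nth 0%N (steps p) n.-1 = nth 0%N (steps s) n.
    have [_ _ _ ->] := fuseP E.
    rewrite nth_cat size_takel ?sz; last lia.
    rewrite ltnNge (_ : (m <= n.-1)%N); last lia.
    rewrite /= (_ : (n.-1 - m)%N = (n - m).-2.+1); last lia.
    by rewrite /= nth_drop; congr nth; lia.
  case: eqP => [s2|_]; last by rewrite raddf0.
  by rewrite (insertion_face s2) -?mi ?E //; lia.
have := raddf0 (fglift reinsert); rewrite -[in X in X = _]bc /bd raddf_sum.
have ik : (i < k)%N by lia.
rewrite (bigD1 (Ordinal ik)) //= big1 ?addr0 => [|m mi]; last first.
  by rewrite fgliftZ reinsert_face ?ltn_ord // ifN ?scaler0.
rewrite fgliftZ reinsert_face // eqxx.
move=> /(congr1 (fun z => (-1) ^+ i.+1 *: z)).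
by rewrite scalerA -expr2 sqrr_sign scale1r scaler0.
Qed.

(** An erasure beyond the inserted vertex leaves the first [n.+1] steps, which
    are unit. *)
Lemma insertion_long_face_right k l n m s : (n < m)%N ->
  word k.+1 l s -> unit_prefix n s -> (n <= k)%N ->
  supported (fun p => word k.+1 l p && unit_prefix n.+1 p)
    (face_op m (insertion_long n s)).
Proof.
move=> nm sw sn nk; rewrite /insertion_long.
case: eqP => [s2|_]; last by rewrite raddf0 supported0.
have sz : size (steps s) = k.+1 by rewrite size_steps; case/and3P: sw => /eqP->.
apply: supported_fglift (insertion_supported s2) _ => p.
case/andP=> /eqP sp /eqP ep; rewrite /fuse_chain.
case E: (fuse m p) => [q|] /=; last exact: supported0.
have [mp _ _ eq] := fuseP E; apply/supportedU/andP; split.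
  exact: fuse_word E (unfuse_word sw s2 sp ep).
have st : size (take n (steps s)) = n by rewrite size_takel // sz ltnW.
have eq1 : take n.+1 (steps q) = take n.+1 (steps p).
  by rewrite eq takel_cat ?take_takel // size_takel // size_steps; lia.
rewrite /unit_prefix eq1 ep take_cat st ltnNge leqnSn subSn // subnn /=.
rewrite ?take0 all_cat /=.
by rewrite andbT; exact: sn.
Qed.

(** The correction term is the insertion into the long steps [n]; the sign is
    that of the face that erases the inserted vertex. *)
Lemma extend_unit_prefix k l n c : (n <= k)%N ->
  supported (fun s => word k.+1 l s && unit_prefix n s) c -> bd k c = 0 ->
  exists2 b, supported (word k.+2 l) b &
    supported (fun s => word k.+1 l s && unit_prefix n.+1 s) (c - bd k.+1 b).
Proof.
move=> nk cP bc; pose b := fglift (insertion_long n) c.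
exists ((-1) ^+ n.+1 *: b).
  apply: supportedZ; apply: supported_fglift cP _ => s /andP[sw _].
  rewrite /insertion_long; case: eqP => [s2|_]; last exact: supported0.
  have := insertion_supported s2; rewrite /supported.
  move=> /allP h; apply/allP => p /h /andP[/eqP sp /eqP ep].
  exact: unfuse_word sw s2 sp ep.
rewrite bdZ /bd scaler_sumr.
rewrite (bigD1 (Ordinal (nk : (n < k.+1)%N))) //= scalerA -expr2 sqrr_sign.
rewrite scale1r opprD addrA.
apply: supportedB; last first.
  apply: supported_sum => m mn; rewrite scalerA; apply: supportedZ.
  have [lmn|lnm|emn] := ltngtP m n; last by rewrite -val_eqE /= emn eqxx in mn.
    rewrite (@insertion_long_face_left m n c k) ?supported0 //.
    by move: cP; apply: sub_all => s /andP[/and3P[-> _ _] ->].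
  rewrite [face_op _ _]fglift_comp.
  apply: supported_fglift cP _ => s /andP[sw sn].
  exact: insertion_long_face_right.
pose short s : chain := if nth 0%N (steps s) n == 2%N then 0 else << s >>.
(* Removing the words whose step [n] is long leaves those where it is unit. *)
have -> : c - face_op n b = fglift short c.
  rewrite [face_op _ _]fglift_comp -[X in X - _]freeg_sumE !fglift_sum -sumrB.
  apply: eq_bigr => s _; rewrite /insertion_long /short.
  rewrite freegUE; case: eqP => [s2|_].
    by rewrite [fglift _ _](insertion_face_across s2) subrr scaler0.
  by rewrite [fglift _ _]raddf0 scaler0 subr0.
apply: supported_fglift cP _ => s /andP[sw sn]; rewrite /short.
case: eqP => [_|s2]; first exact: supported0.
apply: supportedU; rewrite sw /=.
have sz : (n < size (steps s))%N.
  by rewrite size_steps; case/and3P: sw => /eqP->.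
rewrite /unit_prefix (take_nth 0%N) // all_rcons -/(unit_prefix n s) sn.
rewrite andbT /=.
have := step_le2 s n; case/and3P: sw => _ s0 _.
have : nth 0%N (steps s) n != 0%N.
  by apply: contraNneq s0 => <-; apply: mem_nth.
by move: s2; case: (nth _ _ _) => [|[|[]]].
Qed.

(** After [k.+1] extensions only words made of [k.+1] unit steps remain, and
    their length is [k.+1], not [l]. *)
Lemma exact_off_diagonal k l c : k.+1 <> l ->
  supported (word k.+1 l) c -> bd k c = 0 ->
  exists2 b, supported (word k.+2 l) b & bd k.+1 b = c.
Proof.
move=> kl cw bc.
have extend n : (n <= k.+1)%N -> exists2 b, supported (word k.+2 l) b &
    supported (fun s => word k.+1 l s && unit_prefix n s) (c - bd k.+1 b).
  elim: n => [_|n IH nk].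
    exists 0; first exact: supported0.
    rewrite raddf0 subr0; move: cw; apply: sub_all => s ->.
    by rewrite /unit_prefix take0.
  have [b bw bP] := IH (ltnW nk).
  have [|b' b'w b'P] := extend_unit_prefix (nk : (n <= k)%N) bP.
    by rewrite raddfB /= bc bd_bd subrr.
  exists (b + b'); first exact: supportedD.
  by rewrite raddfD /= opprD addrA.
have [b bw cb] := extend k.+1 (leqnn _).
exists b => //; apply/esym/eqP; rewrite -subr_eq0; apply/eqP.
apply: supported_eq0 cb => s; apply/negP => /andP[/and3P[/eqP ss _ /eqP sl]].
rewrite /unit_prefix take_oversize ?size_steps ?ss // => /all_pred1P es.
by case: kl; rewrite -sl es sumn_nseq mul1n size_steps ss.
Qed.
End TwoSides.

(** * The magnitude complex in diameter two *)

Lemma dist_min (G : graph) (u v : G) m :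
  walk u v m -> (forall n, (n < m)%N -> ~~ walk u v n) -> dist u v = Some m.
Proof.
move=> um umin; rewrite /dist; case: pselect => [ex|[]]; last by exists m.
case: ex_minnP => n un nmin; congr Some; apply/eqP; rewrite eqn_leq nmin //=.
by rewrite leqNgt; apply/negP => /umin; rewrite un.
Qed.

Lemma dist_step (G : graph) (u v : G) :
  (u != v -> ~~ edge u v -> exists w, edge u w && edge w v) ->
  dist u v = Some (step u v).
Proof.
move=> mid.
have walk0 : walk u v 0 = (u == v).
  by apply/existsP/idP => [[p]|uv]; [rewrite tuple0 | exists [tuple]].
have walk1 : walk u v 1 = edge u v.
  apply/existsP/idP => [[p]|uv]; last by exists [tuple v]; rewrite /= uv /=.
  by case/tupleP: p => x p; rewrite tuple0 /= andbT => /andP[ux /eqP <-].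
rewrite /step; case: ifP => uv; first by apply: dist_min; rewrite ?walk0.
case: ifP => ev; apply: dist_min; rewrite ?walk1 //.
- by case=> //; rewrite walk0 uv.
- have [||w uwv] := mid; rewrite ?uv ?ev //.
  by apply/existsP; exists [tuple w; v]; rewrite /= andbT eqxx andbT.
case=> [|[|]] // _.
- by rewrite walk0 uv.
- by rewrite walk1 ev.
Qed.

Section Complex.
Variable G : graph.
Hypothesis dist_stepE : forall u v : G, dist u v = Some (step u v).
Implicit Types (s p : seq G) (u v w x y : G).
Local Notation chain := {freeg (seq G) / int}.

Lemma lenE s : len s = Some (sumn (steps s)).
Proof.
case: s => //= x s; elim: s x => [|y s IH] x /=; first by rewrite big_nil.
by rewrite big_cons IH dist_stepE.
Qed.

Lemma sorted_neqE s : sorted (fun u v => u != v) s = (0%N \notin steps s).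
Proof.
case: s => //= x s; elim: s x => [|y s IH] x //=.
rewrite inE negb_or IH; congr (_ && _); rewrite /step.
by case: ifP => // _; case: ifP.
Qed.

Lemma generatingE k l (x : k.+1.-tuple G) : generating l x = word k l x.
Proof. by rewrite /generating /word size_tuple eqxx lenE sorted_neqE. Qed.

Lemma omitE k (i : 'I_k.+2) (x : k.+2.-tuple G) :
  omit i x = take i x ++ drop i.+1 x :> seq G.
Proof.
have sx := size_tuple x; have x0 := tnth x i; have li := ltn_ord i.
apply: (@eq_from_nth _ x0); rewrite size_tuple.
  by rewrite size_cat size_takel ?size_drop sx //; lia.
move=> j lj.
rewrite -(tnth_nth x0 _ (Ordinal lj)) tnth_mktuple (tnth_nth x0) /=.
rewrite nth_cat size_takel ?sx ?(ltnW li) // /bump.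
case: ltnP => ji; first by rewrite nth_take ?add0n.
by rewrite nth_drop; congr nth; lia.
Qed.

(** Erasing [v] from [u, v, w] replaces d(u, v) + d(v, w) >= 2 by d(u, w) <= 2,
    so the length is kept only if both distances are 1 and d(u, w) = 2. *)
Lemma fuse_omit i s : 0%N \notin steps s -> (i.+2 < size s)%N ->
  fuse i s = if sumn (steps (take i.+1 s ++ drop i.+2 s)) == sumn (steps s)
             then Some (take i.+1 s ++ drop i.+2 s) else None.
Proof.
elim: i s => [|i IH] [|u s] //.
  case: s => [|v [|w s]] //=; rewrite !inE !negb_or => /and3P[uv vw _] _.
  rewrite fuse0 ?take0 /= ?drop0 addnA eqn_add2r; congr (if _ then _ else _).
  have h x y : (step x y <= 2)%N by have := step_le2 [:: x; y] 0.
  by move: (h u v) (h v w) (h u w) uv vw; case: (step u v) (step v w) (step u w)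
    => [|[|[|]]] // [|[|[|]]] // [|[|[|]]].
case: s => [|v s] //; rewrite /= inE negb_or => /andP[_ s0]; rewrite ltnS => si.
by rewrite fuseS IH //= eqn_add2l; case: ifP.
Qed.

Definition embed k l : MC G k l -> chain :=
  fglift (fun x : gen G k l => << tval (val x) >>).

HB.instance Definition _ k l := GRing.Additive.on (@embed k l).

(** The inverse of [embed] on chains of words; words of another degree or
    length are sent to 0. *)
Definition restrict k l : chain -> MC G k l :=
  fglift (fun s => oapp (fun x : gen G k l => << x >>) 0
    (obind insub (insub s : option (k.+1.-tuple G)))).

Lemma embedK k l : cancel (@embed k l) (@restrict k l).
Proof.
move=> c; rewrite [LHS]fglift_comp -[RHS]freeg_sumE fglift_sum.
apply: eq_bigr => x _; rewrite [fglift _ _]fglift1.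
have -> : insub (tval (val x)) = Some (val x) := valK (val x).
by rewrite /= valK /= [RHS]freegUE.
Qed.

Lemma restrictK k l c : supported (word k l) c -> embed (restrict k l c) = c.
Proof.
move=> cw; rewrite [LHS]fglift_comp -[RHS]freeg_sumE fglift_sum.
apply: eq_big_seq => s /(allP cw) sw.
have ss : size s == k.+1 by case/and3P: sw.
have sg : generating l (Tuple ss) by rewrite generatingE.
have -> : insub s = Some (Tuple ss) := valK (Tuple ss).
by rewrite /= insubT /= [fglift _ _]fglift1 [RHS]freegUE.
Qed.

Lemma embed_supported k l (c : MC G k l) : supported (word k l) (embed c).
Proof.
apply: (@supported_fglift _ _ predT); first by apply/allP.
by move=> x _; rewrite supportedU // -generatingE; exact: (valP x).
Qed.

Lemma embed_face k l (i : 'I_k.+2) (x : gen G k.+1 l) : (0 < i < k.+1)%N ->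
  embed (face i x) = fuse_chain i.-1 (val x).
Proof.
move=> /andP[i0 ik].
have xw : word k.+1 l (val x) by rewrite -generatingE; exact: (valP x).
have /and3P[/eqP sx x0 /eqP xl] := xw.
have := @fuse_omit i.-1 (val x) x0; rewrite sx prednK // => /(_ ltac:(lia)).
rewrite xl -omitE /face /fuse_chain; case: insubP => [y yg ey|].
  rewrite generatingE in yg; case/and3P: yg => _ _ -> -> /=.
  by rewrite [embed _]fglift1 ey.
rewrite generatingE raddf0 => /negP nw; case: ifP => [_ E|_ ->] //.
by case: nw; exact: fuse_word E xw.
Qed.

Lemma embed_boundary k l (c : MC G k.+1 l) :
  embed (boundary c) = bd k (embed c).
Proof.
rewrite [LHS]fglift_comp [in RHS]/embed fglift_sum [in RHS]fglift_sum raddf_sum.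
apply: eq_bigr => x _; rewrite /= bdZ; congr (_ *: _).
rewrite -/(embed _) raddf_sum big_mkcond big_ord_recl /= add0r.
rewrite big_ord_recr /= ltnn addr0.
apply: eq_bigr => i _; rewrite /bump /= add1n ltnS ltn_ord.
rewrite [embed _]fgliftZ -/(embed _).
rewrite embed_face /= ?/bump ?add1n ?ltnS ?ltn_ord //.
by rewrite [face_op _ _]fglift1.
Qed.

Lemma diagonal_of_exact :
  (forall k l (c : chain), k.+1 <> l ->
    supported (word k.+1 l) c -> bd k c = 0 ->
    exists2 b, supported (word k.+2 l) b & bd k.+1 b = c) ->
  diagonal G.
Proof.
move=> exactness k l kl; elim/quotW => z; apply/eqP.
rewrite -[X in _ == X](raddf0 \pi_(MH G k l)%qT) -Quotient.idealrBE subr0.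
apply/asboolP; case: k kl z => [|k] kl [c cP] /=.
  (* A word with one entry has length 0, which is not [l]: no chains here. *)
  exists 0; rewrite raddf0 -(embedK c); apply: esym.
  rewrite (supported_eq0 _ (embed_supported c)) => [|s]; first exact: raddf0.
  by apply/negP => /and3P[]; case: s => [|x []] //= _ _ /eqP.
have /eqP bc : boundary c == 0 by [].
have [|b bw bb] := exactness k l (embed c) kl (embed_supported c).
  by rewrite -embed_boundary bc raddf0.
exists (restrict k.+2 l b); apply: (can_inj (@embedK _ _)).
by rewrite embed_boundary restrictK.
Qed.
End Complex.

(** * Joins *)

Section JoinSides.
Variables G H : graph.

Definition in_left (u : join G H) : bool := if u is inl _ then true else false.

Lemma in_left_cross (u v : join G H) : in_left u != in_left v -> edge u v.
Proof. by case: u v => x [] y. Qed.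

End JoinSides.

Theorem theorem37 (G H : graph) (hG : (0 < #|G|)%N) (hH : (0 < #|H|)%N) :
  diagonal (join G H).
Proof.
have [/card_gt0P[g _] /card_gt0P[h _]] := (hG, hH).
pose across (u : join G H) : join G H := if u is inl _ then inr h else inl g.
have side_across u : in_left (across u) != in_left u by case: u.
apply: diagonal_of_exact => [u v|k l c]; last first.
  exact: (exact_off_diagonal (@in_left_cross G H) side_across).
apply: dist_step => _ nuv; exists (across u).
have /eqP uv : in_left u == in_left v by apply: contraNT nuv => /in_left_cross.
by rewrite !in_left_cross // -?uv // eq_sym.
Qed.
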